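(* Let $n,b,\bar m\ge1$ be integers, $\mathbf{\Phi}=(\phi_{ij})\in\mathbb{R}^{n\times b}$, and $\mathbf{y}\in\{0,1\}^n$. Consider the generalized linear logistic regression model with class-conditional probability $\Pr(y_i=0\mid\mathbf{w})=\big(1+\exp(-\mathbf{\Phi}[i,:]\,\mathbf{w})\big)^{-1}$, where the training examples are sampled independently, so that $\Pr(\mathbf{y}\mid\mathbf{w})=\prod_{i=1}^n\Pr(y_i\mid\mathbf{w})$. Let the $j$-th latent variable $w_j$ take values in the entries of $\bar{\mathbf{w}}_j\in\mathbb{R}^{\bar m}$, and let the variational distribution be factorized with probability vectors $\mathbf{q}_1,\dots,\mathbf{q}_b\in(0,1)^{\bar m}$ (each with entries summing to $1$). Then $$\mathbf{q}^T\log\boldsymbol{\ell}\;\ge\;-\mathbf{s}^T(\mathbf{\Phi}^T\mathbf{y})-\sum_{i=1}^n\begin{cases}\displaystyle\prod_{j=1}^b\mathbf{q}_j^T\exp(-\phi_{ij}\bar{\mathbf{w}}_j)&\text{if }y_i=0,\\[2mm]\displaystyle\prod_{j=1}^b\mathbf{q}_j^T\exp(\phi_{ij}\bar{\mathbf{w}}_j)-\sum_{j=1}^b\mathbf{q}_j^T\phi_{ij}\bar{\mathbf{w}}_j&\text{if }y_i=1,\end{cases}$$ where $\mathbf{s}=(\mathbf{q}_j^T\bar{\mathbf{w}}_j)_{j=1}^b\in\mathbb{R}^b$.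
   Context: $\mathbf{\Phi}[i,:]$ is the $i$-th row of $\mathbf{\Phi}$; $\exp$ and $\log$ of vectors are elementwise. Write $\bar w_{jk}$ and $q_{jk}$ for the $k$-th entries of $\bar{\mathbf{w}}_j$ and $\mathbf{q}_j$. The vectors $\mathbf{q}=\bigotimes_{j=1}^b\mathbf{q}_j$ and $\log\boldsymbol{\ell}$ in $\mathbb{R}^{\bar m^b}$ are indexed by the points of the support grid: for $k=(k_1,\dots,k_b)\in\{1,\dots,\bar m\}^b$ with $\mathbf{w}_k=(\bar w_{1k_1},\dots,\bar w_{bk_b})^T$, the entries are $q_k=\prod_{j=1}^b q_{jk_j}$ and $(\log\boldsymbol{\ell})_k=\log\Pr(\mathbf{y}\mid\mathbf{w}_k)$, so that $\mathbf{q}^T\log\boldsymbol{\ell}=\sum_{k}q_k\log\Pr(\mathbf{y}\mid\mathbf{w}_k)$ is the expected log-likelihood under the variational distribution. *)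

(* Defs.v *)
From HB Require Import structures.
From mathcomp Require Import all_boot all_order all_algebra.
From mathcomp Require Import reals sequences exp.

Set Implicit Arguments.
Unset Strict Implicit.
Unset Printing Implicit Defensive.

Import Order.TTheory GRing.Theory Num.Theory.
Local Open Scope ring_scope.

Definition dotv (R : realType) (n : nat) (u v : 'cV[R]_n) : R :=
  (u^T *m v) 0 0.

(* Labels are booleans: false is the class 0 and true is the class 1. *)
Definition class_prob (R : realType) (n b : nat) (Phi : 'M[R]_(n, b))
    (w : 'cV[R]_b) (i : 'I_n) (c : bool) : R :=
  let p0 := (1 + expR (- (row i Phi *m w) 0 0))^-1 in
  if c then 1 - p0 else p0.

Definition likelihood (R : realType) (n b : nat) (Phi : 'M[R]_(n, b))
    (y : 'cV[bool]_n) (w : 'cV[R]_b) : R :=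
  \prod_(i < n) class_prob Phi w i (y i 0).

Definition label_vec (R : realType) (n : nat) (y : 'cV[bool]_n) : 'cV[R]_n :=
  map_mx (fun c : bool => c%:R) y.

(* Multi-indices (k_1, ..., k_b). Vectors of R^(m^b) are represented as finite
   functions on these multi-indices, without linearizing them. *)
Definition grid (b m : nat) := {ffun 'I_b -> 'I_m}.

Definition grid_point (R : realType) (b m : nat) (wbar : 'I_b -> 'cV[R]_m)
    (k : grid b m) : 'cV[R]_b :=
  \col_(j < b) wbar j (k j) 0.

Definition tensor (R : realType) (b m : nat) (q : 'I_b -> 'cV[R]_m) :
    {ffun grid b m -> R} :=
  [ffun k : grid b m => \prod_(j < b) q j (k j) 0].

Definition loglik (R : realType) (n b m : nat) (Phi : 'M[R]_(n, b))
    (y : 'cV[bool]_n) (wbar : 'I_b -> 'cV[R]_m) : {ffun grid b m -> R} :=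
  [ffun k : grid b m => ln (likelihood Phi y (grid_point wbar k))].

Definition dotg (R : realType) (b m : nat) (u v : {ffun grid b m -> R}) : R :=
  \sum_(k : grid b m) u k * v k.

Definition mean_vec (R : realType) (b m : nat) (q wbar : 'I_b -> 'cV[R]_m) :
    'cV[R]_b :=
  \col_(j < b) dotv (q j) (wbar j).

(* Main.v *)
(* Since [ln (1 + x) <= x], each log-probability is at least minus an exponential
   of a linear form in [w]; the expectation of that exponential under a
   factorized distribution is a product of one-dimensional expectations. For the
   examples of class 1 the linear terms on the right-hand side cancel. *)
Require Import Defs.
From HB Require Import structures.
From mathcomp Require Import all_boot all_order all_algebra.
From mathcomp Require Import reals sequences exp.
From mathcomp Require Import ring.

Set Implicit Arguments.
Unset Strict Implicit.
Unset Printing Implicit Defensive.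

Import Order.TTheory GRing.Theory Num.Theory.
Local Open Scope ring_scope.

Lemma ln_prod (R : realType) (I : Type) (r : seq I) (P : pred I) (F : I -> R) :
  (forall i, P i -> 0 < F i) ->
  ln (\prod_(i <- r | P i) F i) = \sum_(i <- r | P i) ln (F i).
Proof.
move=> F_gt0.
(* Positivity of the partial product is carried through the induction, because [lnM] needs both
   factors positive. *)
suff [] : 0 < \prod_(i <- r | P i) F i /\
  ln (\prod_(i <- r | P i) F i) = \sum_(i <- r | P i) ln (F i) by [].
elim/big_rec2: _ => [|i s p Pi [p_gt0 <-]]; first by rewrite ln1.
by split; [rewrite mulr_gt0 ?F_gt0 | rewrite lnM ?posrE ?F_gt0].
Qed.

(** Since [1 - (1 + exp (- z))^-1 = (1 + exp z)^-1], the two classes differ only by the sign of the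
    row of [Phi], so both can be treated at once. *)
Lemma class_probE (R : realType) (n b : nat) (Phi : 'M[R]_(n, b))
    (w : 'cV[R]_b) (i : 'I_n) (c : bool) :
  class_prob Phi w i c =
  (1 + expR (\sum_(j < b) (if c then Phi i j else - Phi i j) * w j 0))^-1.
Proof.
have rowE : (row i Phi *m w) 0 0 = \sum_(j < b) Phi i j * w j 0.
  by rewrite mxE; apply: eq_bigr => j _; rewrite mxE.
rewrite /class_prob rowE; case: c.
  set z := \sum_(j < b) _; have e_gt0 := expR_gt0 z.
  rewrite expRN; field.
  by rewrite !lt0r_neq0 // addr_gt0.
by congr (1 + expR _)^-1; rewrite -sumrN; apply: eq_bigr => j _; rewrite mulNr.
Qed.

Lemma class_prob_gt0 (R : realType) (n b : nat) (Phi : 'M[R]_(n, b))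
    (w : 'cV[R]_b) (i : 'I_n) (c : bool) : 0 < class_prob Phi w i c.
Proof. by rewrite class_probE invr_gt0 addr_gt0 ?expR_gt0. Qed.

(** The exponential is split over the coordinates, the shape whose expectation [tensor_prodE]
    computes. *)
Lemma ln_class_prob_ge (R : realType) (n b : nat) (Phi : 'M[R]_(n, b))
    (w : 'cV[R]_b) (i : 'I_n) (c : bool) :
  - \prod_(j < b) expR ((if c then Phi i j else - Phi i j) * w j 0)
    <= ln (class_prob Phi w i c).
Proof.
rewrite class_probE -expR_sum; set z := \sum_(j < b) _.
have e_gt0 := expR_gt0 z.
by rewrite lnV ?posrE ?addr_gt0 // lerN2 le_ln1Dx // (lt_trans _ e_gt0) ?ltrN10.
Qed.

(** Independence of the coordinates: expanding the product of sums on the right gives one term per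
    multi-index. *)
Lemma tensor_prodE (R : realType) (b m : nat) (q : 'I_b -> 'cV[R]_m)
    (g : 'I_b -> 'cV[R]_m) :
  \sum_(k : grid b m) tensor q k * \prod_(j < b) g j (k j) 0 =
  \prod_(j < b) dotv (q j) (g j).
Proof.
under [RHS]eq_bigr => j _.
  rewrite /dotv mxE.
  under eq_bigr => l _ do rewrite mxE.
  over.
rewrite bigA_distr_bigA; apply: eq_bigr => k _.
by rewrite ffunE big_split.
Qed.

(** Regrouping by example lets the linear term be merged, summand by summand, with the other sum of
    the bound. *)
Lemma mean_vec_dotE (R : realType) (n b m : nat) (Phi : 'M[R]_(n, b))
    (y : 'cV[bool]_n) (wbar q : 'I_b -> 'cV[R]_m) :
  dotv (mean_vec q wbar) (Phi^T *m label_vec R y) =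
  \sum_(i < n) if y i 0 then \sum_(j < b) dotv (q j) (Phi i j *: wbar j) else 0.
Proof.
rewrite /dotv mxE.
under eq_bigr => j _ do rewrite !mxE mulr_sumr.
rewrite exchange_big; apply: eq_bigr => i _.
case: ifP => yi; last first.
  by apply: big1 => j _; rewrite !mxE yi !mulr0.
apply: eq_bigr => j _.
by rewrite -scalemxAr [RHS]mxE -/(dotv _ _) !mxE yi mulr1 mulrC.
Qed.

Theorem theorem2 (R : realType) (n b m : nat)
    (n_ge1 : (1 <= n)%N) (b_ge1 : (1 <= b)%N) (m_ge1 : (1 <= m)%N)
    (Phi : 'M[R]_(n, b)) (y : 'cV[bool]_n)
    (wbar q : 'I_b -> 'cV[R]_m)
    (q_itv : forall (j : 'I_b) (k : 'I_m), 0 < q j k 0 < 1)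
    (q_sum : forall j : 'I_b, \sum_(k < m) q j k 0 = 1) :
  dotg (tensor q) (loglik Phi y wbar) >=
    - dotv (mean_vec q wbar) (Phi^T *m label_vec R y)
    - \sum_(i < n)
        (if y i 0 then
           \prod_(j < b) dotv (q j) (map_mx (@expR R) (Phi i j *: wbar j))
           - \sum_(j < b) dotv (q j) (Phi i j *: wbar j)
         else
           \prod_(j < b) dotv (q j) (map_mx (@expR R) (- Phi i j *: wbar j))).
Proof.
rewrite mean_vec_dotE -opprD -big_split /=.
pose g i j := map_mx (@expR R) ((if y i 0 then Phi i j else - Phi i j) *: wbar j).
rewrite (eq_bigr (fun i => \prod_(j < b) dotv (q j) (g i j))); last first.
  by move=> i _; rewrite /g; case: (y i 0); rewrite ?add0r // addrC subrK.
under eq_bigr => i _ do rewrite -tensor_prodE.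
(* After the exchange both sides are sums with the nonnegative weights [tensor q k], so comparing
   them at each grid point suffices. *)
rewrite exchange_big -sumrN; apply: ler_sum => k _.
rewrite -mulr_sumr -mulrN; apply: ler_wpM2l.
  by rewrite ffunE prodr_ge0 // => j _; case/andP: (q_itv j (k j)) => /ltW.
rewrite ffunE ln_prod => [|i _]; last exact: class_prob_gt0.
rewrite -sumrN; apply: ler_sum => i _.
(* The two products agree once the matrix entries are unfolded, so the equality case is taken. *)
apply: le_trans (ln_class_prob_ge _ _ _ _); rewrite lerN2 le_eqVlt.
by apply/orP; left; apply/eqP/eq_bigr => j _; rewrite !mxE.
Qed.
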